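(* If $M$ is an $n\times n$ matrix with only one simple eigenvalue of maximal modulus $\rho=|\lambda_1|>|\lambda_2|$, then the derivative $g$ of the function $f\circ u$ at $M$, such that $$g_{ij}=\sum_k\frac{\partial f}{\partial u_k}\frac{\partial u_k}{\partial M_{ij}},$$ is the limit of the sequence of matrices $(\tilde w_l u_l^T)_{l\ge 0}$ given by the following iterative scheme: $$u_{l+1}=\frac{M u_l}{N(M u_l)},\qquad v_{l+1}^T=\frac{v_l^T M}{v_l^T M u_{l+1}},$$ $$\tilde w_{l+1}^T=\frac{1}{\rho_l}\bigl(\nabla f_l^T-(\nabla f_l\cdot u_l)\nabla N_l^T+\tilde w_l^T M\bigr)\bigl(I-u_{l+1}v_{l+1}^T\bigr),$$ where $\rho_l=N(Mu_l)$, $\nabla f_l=\nabla f(u_l)$ and $\nabla N_l=\nabla N(u_l)$. Moreover, the sequences $(u_l)$, $(v_l)$ and $(\tilde w_l)$ converge linearly with rate $\frac{|\lambda_2|}{\rho}$.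
   Context: The eigenvalues of $M$ are ordered by decreasing modulus, $\lambda_1$ being the principal eigenvalue (the one of maximal modulus) and $\lambda_2$ one of second largest modulus. $f:\mathbb{R}^n\to\mathbb{R}$ is continuously differentiable. $u=u(M)$ is the right eigenvector of $M$ for its simple principal eigenvalue, normalized by $N(u)=1$, regarded as a function of the entries of the matrix; $f\circ u$ is the function $M\mapsto f(u(M))$. The normalization function $N$ is assumed to be differentiable at $u$ and to satisfy $N(\alpha u)=\alpha N(u)$ for all nonnegative scalars $\alpha$. The scheme is started from vectors $u_0,v_0,\tilde w_0$. Vectors are column vectors and $I$ is the identity matrix. A sequence $(x_k)_{k\ge0}$ is said to converge to a point $x$ with a linear convergence rate $\alpha$ if $\limsup_{k\to\infty}\|x_k-x\|^{1/k}\le\alpha$.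
   Formalization: Added: u_0, v_0 not orthogonal to the left/right principal eigenvectors; N odd, or λ_1, v·u_0 and all N(Mu_l) positive; for the limits of w̃_l and w̃_l u_l^T, N is C^1 at u; for the rate of w̃_l, ∇f and ∇N are Lipschitz at u. The English fails without these. *)

(* Defs.v *)
From HB Require Import structures.
From mathcomp Require Import all_boot all_order all_algebra.
From mathcomp Require Import complex.
From mathcomp Require Import all_classical all_reals all_analysis.

Set Implicit Arguments.
Unset Strict Implicit.
Unset Printing Implicit Defensive.

Import Order.TTheory GRing.Theory Num.Theory.
Import numFieldNormedType.Exports.

Local Open Scope classical_set_scope.
Local Open Scope ring_scope.

Definition toC (R : realType) (m n : nat) (A : 'M[R]_(m, n)) : 'M[R[i]]_(m, n) :=
  map_mx (real_complex R) A.

Definition dot (R : realType) (n : nat) (x y : 'cV[R]_n) : R :=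
  \sum_(k < n) x k 0 * y k 0.

(* The value at [x] is the usual gradient when [F] is differentiable at [x]. *)
Definition gradient (R : realType) (n : nat) (F : 'cV[R]_n -> R)
    (x : 'cV[R]_n) : 'cV[R]_n :=
  \col_k 'D_(delta_mx k 0) F x.

Definition modulus (R : realType) (z : R[i]) : R := ComplexField.Normc.normc z.

(* All complex eigenvalues of [A], listed with algebraic multiplicity and by
   decreasing modulus. *)
Definition spectrum (R : realType) (n : nat) (A : 'M[R]_n) (s : seq R[i]) : Prop :=
  char_poly (toC A) = \prod_(z <- s) ('X - z%:P) /\
  sorted (fun z z' : R[i] => modulus z' <= modulus z) s.

(* The inequality says that s`_0 is simple and is the only eigenvalue of
   maximal modulus.  If [A] has size 1, then s`_1 is the default value 0. *)
Definition dominant_spectrum (R : realType) (n : nat) (A : 'M[R]_n)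
    (s : seq R[i]) : Prop :=
  spectrum A s /\ modulus s`_1 < modulus s`_0.

(* [x] needs no separate hypothesis of being nonzero: it will have N x = 1 with
   N positively homogeneous. *)
Definition principal_eigenvector (R : realType) (n : nat) (N : 'cV[R]_n -> R)
    (A : 'M[R]_n) (x : 'cV[R]_n) : Prop :=
  exists s : seq R[i],
    [/\ dominant_spectrum A s, toC A *m toC x = s`_0 *: toC x & N x = 1].

(* A branch of the normalized principal eigenvector around [M].  Continuity at
   [M] selects the branch: if N (- x) = N x, the normalization alone leaves the
   sign of the eigenvector free. *)
Definition principal_branch (R : realType) (n : nat) (N : 'cV[R]_n -> R)
    (M : 'M[R]_n) (U : 'M[R]_n -> 'cV[R]_n) : Prop :=
  (\forall A \near M, principal_eigenvector N A (U A)) /\ {for M, continuous U}.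

(* All vectors are columns; the recurrences for v and w are written for the
   transposed (row) vectors.  The scheme divides by N (M u_l) and by
   v_l^T M u_{l+1}, so these are required not to vanish. *)
Definition iterative_scheme (R : realType) (n : nat) (f N : 'cV[R]_n -> R)
    (M : 'M[R]_n) (u_ v_ w_ : nat -> 'cV[R]_n) : Prop :=
  forall l : nat,
    let rho := N (M *m u_ l) in
    let d := ((v_ l)^T *m M *m u_ l.+1) 0 0 in
    let df := gradient f (u_ l) in
    let dN := gradient N (u_ l) in
    [/\ rho != 0 /\ d != 0,
        u_ l.+1 = rho^-1 *: (M *m u_ l),
        (v_ l.+1)^T = d^-1 *: ((v_ l)^T *m M) &
        (w_ l.+1)^T =
          rho^-1 *: ((df^T - dot df (u_ l) *: dN^T + (w_ l)^T *m M)
                       *m (1%:M - u_ l.+1 *m (v_ l.+1)^T))].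

(* limsup_k ||x_k - x||^(1/k) <= a; the term k = 0 is irrelevant. *)
Definition linear_cvg (R : realType) (V : normedModType R) (x_ : nat -> V)
    (x : V) (a : R) : Prop :=
  (limn_esup (fun k : nat => (`|x_ k - x| `^ (k%:R)^-1)%:E) <= a%:E)%E.

Definition continuously_differentiable (R : realType) (n : nat)
    (F : 'cV[R]_n -> R) : Prop :=
  (forall x, differentiable F x) /\ continuous (gradient F).

Definition continuously_differentiable_at (R : realType) (n : nat)
    (F : 'cV[R]_n -> R) (x : 'cV[R]_n) : Prop :=
  (\forall y \near x, differentiable F y) /\ {for x, continuous (gradient F)}.

Definition gradient_lipschitz_at (R : realType) (n : nat)
    (F : 'cV[R]_n -> R) (x : 'cV[R]_n) : Prop :=
  exists K : R, \forall y \near x,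
    `|gradient F y - gradient F x| <= K * `|y - x|.

Definition chain_rule_derivative (R : realType) (n : nat) (f : 'cV[R]_n -> R)
    (U : 'M[R]_n -> 'cV[R]_n) (M : 'M[R]_n) : 'M[R]_n :=
  \matrix_(i, j) \sum_(k < n)
    gradient f (U M) k 0 * 'D_(delta_mx i j) (fun A : 'M[R]_n => U A k 0) M.

(* A positively homogeneous N fixes u_l only up to the sign of the multiple of
   the principal eigenvector that the power iteration approaches.  Either N is
   odd, and the normalization corrects this sign, or all the signs must be
   positive.  [v] is the left principal eigenvector with dot v u = 1. *)
Definition sign_condition (R : realType) (n : nat) (N : 'cV[R]_n -> R)
    (M : 'M[R]_n) (lambda1 : R[i]) (v : 'cV[R]_n) (u_ : nat -> 'cV[R]_n) : Prop :=
  (forall x, N (- x) = - N x) \/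
  [/\ 0 < lambda1, 0 < dot v (u_ 0%N) & forall l, 0 < N (M *m u_ l)].

(* Main.v *)
Require Import Defs.
From HB Require Import structures.
From mathcomp Require Import all_boot all_order all_algebra.
From mathcomp Require Import complex.
From mathcomp Require Import all_classical all_reals all_analysis.
From mathcomp Require Import ring lra.

Set Implicit Arguments.
Unset Strict Implicit.
Unset Printing Implicit Defensive.

Import Order.TTheory GRing.Theory Num.Theory.
Import numFieldNormedType.Exports.

Local Open Scope classical_set_scope.
Local Open Scope ring_scope.

(** Write lambda for the principal eigenvalue, u and v for the right and left
    principal eigenvectors with v^T u = 1, and p for the gradient of N at u.

    Everything rests on the deflated matrix B = M - lambda u v^T. Its
    characteristic polynomial is that of M with the factor X - lambda replaced
    by X ([char_poly_deflation]), so all its eigenvalues have modulus at most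
    |lambda_2|, and its powers are O(r^k) for every r > |lambda_2|
    ([power_bound]). Moreover B - lambda is invertible, which yields the reduced
    resolvent G, with G (M - lambda) = 1 - u v^T and G u = 0
    ([reduced_resolvent]).

    Differentiability of u. If A x = mu x and N x = 1, put H = A - M and
    delta = x - u. Applying G to the difference of the two eigenvector
    equations determines delta modulo u, and the normalization, linearized as
    p . delta = 0, fixes the component along u; here p . u = 1 by Euler's
    identity. Hence delta = - (1 - u p^T) G H u up to terms small with respect
    to delta ([perturbation_identity], [branch_differential]). By the chain
    rule, g = w u^T with w^T = - (grad f)^T (1 - u p^T) G ([response_adjoint]).

    Convergence of the scheme. Rescaled by v . u_l, respectively v_l . u, the
    first two recurrences are affine with linear part T = B / lambda, whose
    powers are O(r^k) for every r > |lambda_2| / |lambda|; the actual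
    normalizations are then recovered by maps that are Lipschitz at the limit
    ([scheme_u_cvg], [scheme_v_cvg]). The third recurrence reads
    w_{l+1}^T = b_l + w_l^T T_l, with T_l -> T and b_l -> b, and the w above is
    the fixed point of the limiting affine map. A perturbed contraction
    converges to that fixed point ([perturbed_cvg]), and it does so linearly
    when the perturbations decay linearly ([perturbed_geometric]). The
    perturbations involve the gradients of f and N at u_l: continuity makes
    them vanish, and a Lipschitz condition at u gives them the rate of u_l. *)

(** * Scalar recurrences and linear convergence *)

(** The constant |C| / (r - q) makes D r^k a supersolution of the recurrence. *)
Lemma geometric_recurrence (R : realType) (q r C : R) (x : nat -> R) :
  0 <= q -> q < r -> (forall k, x k.+1 <= q * x k + C * r ^+ k) ->
  exists D, forall k, x k <= D * r ^+ k.
Proof.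
move=> q0 qr xr; have r0 : 0 < r := le_lt_trans q0 qr.
pose D := `|x 0%N| + `|C| / (r - q).
have CD : C <= (r - q) * D.
  rewrite /D mulrDr mulrCA divff ?gt_eqF ?subr_gt0// mulr1.
  by rewrite (le_trans (ler_norm C))// lerDr mulr_ge0// subr_ge0 ltW.
exists D; elim=> [|k IH].
  rewrite mulr1 (le_trans (ler_norm _))// lerDl.
  by rewrite divr_ge0// subr_ge0 ltW.
rewrite (le_trans (xr k))//.
apply: (@le_trans _ _ (q * (D * r ^+ k) + (r - q) * D * r ^+ k)).
  by rewrite lerD ?ler_wpM2l// ler_pM2r ?exprn_gt0.
by rewrite exprS le_eqVlt; apply/orP; left; apply/eqP; ring.
Qed.

Lemma geometric_recurrence_near (R : realType) (q r C : R) (x : nat -> R) :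
  0 <= q -> q < r ->
  (\forall k \near \oo, x k.+1 <= q * x k + C * r ^+ k) ->
  exists D, \forall k \near \oo, x k <= D * r ^+ k.
Proof.
move=> q0 qr [k0 _ xr]; have r0 : 0 < r := le_lt_trans q0 qr.
have [|D xD] := @geometric_recurrence R q r (C * r ^+ k0)
    (fun j => x (j + k0)%N) q0 qr.
  by move=> j /=; rewrite addSn -mulrA -exprD (addnC k0) xr//= leq_addl.
exists (D / r ^+ k0), k0 => // k /= k0k; rewrite -{1}(subnK k0k).
rewrite (le_trans (xD _))// -{2}(subnK k0k) exprD mulrCA.
by rewrite divfK ?gt_eqF ?exprn_gt0// mulrC.
Qed.

(** Replacing a k by an eventual bound (1 - q) c makes c the fixed point of the
    recurrence, from which the distance contracts with ratio q. *)
Lemma vanishing_recurrence (R : realType) (q : R) (a x : nat -> R) :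
  0 <= q -> q < 1 -> (forall k, 0 <= x k) -> a k @[k --> \oo] --> 0 ->
  (\forall k \near \oo, x k.+1 <= q * x k + a k) -> x k @[k --> \oo] --> 0.
Proof.
move=> q0 q1 x0 a0 xa; apply/cvgr0Pnorm_le => e e0.
have q1' : 0 < 1 - q by rewrite subr_gt0.
pose c := e / 2.
have c0 : 0 < c by rewrite divr_gt0.
have [k0 _ xc] : \forall k \near \oo, x k.+1 <= q * x k + (1 - q) * c.
  have /cvgr0Pnorm_le/(_ _ (mulr_gt0 q1' c0)) ac := a0.
  near=> k; apply: (@le_trans _ _ (q * x k + a k)); first by near: k.
  rewrite lerD2l (le_trans (ler_norm _))//; by near: k.
have step j : x (j + k0)%N <= q ^+ j * x k0 + c.
  elim: j => [|j IH]; first by rewrite expr0 mul1r lerDl ltW.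
  rewrite addSn (le_trans (xc _ (leq_addl _ _)))//.
  have := ler_wpM2l q0 IH; rewrite exprS; lra.
have : q ^+ j * x k0 @[j --> \oo] --> 0.
  rewrite -[X in _ --> X](mul0r (x k0)); apply: cvgMr_tmp.
  by apply: cvg_expr; rewrite ger0_norm.
move=> /cvgr0Pnorm_le/(_ _ c0)[j0 _ qc].
exists (j0 + k0)%N => // k /= j0k; rewrite ger0_norm//.
have k0k : (k0 <= k)%N := leq_trans (leq_addl _ _) j0k.
rewrite -(subnK k0k) (le_trans (step _))// /c [leRHS](splitr e) lerD2r.
by rewrite (le_trans (ler_norm _))// qc//= leq_subRL// addnC.
Unshelve. all: by end_near. Qed.

Lemma geometric_decay (R : realType) (C q r : R) :
  0 < q -> q < r -> \forall k \near \oo, C * q ^+ k <= r ^+ k.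
Proof.
move=> q0 qr; have r0 := lt_trans q0 qr.
have : C * (q / r) ^+ k @[k --> \oo] --> 0.
  rewrite -[X in _ --> X](mulr0 C); apply: cvgMl_tmp.
  apply: cvg_expr; rewrite ger0_norm ?divr_ge0 1?ltW//.
  by rewrite ltr_pdivrMr// mul1r.
move=> /cvgr0Pnorm_le/(_ _ ltr01); apply: filterS => k.
rewrite expr_div_n mulrA => /(le_trans (ler_norm _)).
by rewrite ler_pdivrMr ?exprn_gt0// mul1r.
Qed.

(** The limit superior only sees the exponential order of the error. The room
    between kappa and an arbitrary larger bound absorbs the constant, whose
    k-th root therefore never has to be studied. *)
Lemma linear_cvg_geometric (R : realType) (V : normedModType R)
    (x_ : nat -> V) (x : V) (a : R) : 0 <= a -> a < 1 ->
  (forall r, a < r -> r < 1 ->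
     exists C, \forall k \near \oo, `|x_ k - x| <= C * r ^+ k) ->
  linear_cvg x_ x a.
Proof.
move=> a0 a1 xr; rewrite /linear_cvg; apply/lee_addgt0Pr => e e0.
rewrite -EFinD; set b := a + e.
have [r ar rb] : exists2 r, a < r & r < Num.min 1 b.
  have /midf_lt[h1 h2] : a < Num.min 1 b by rewrite lt_min a1 /b ltrDl.
  by eexists; [exact: h1|exact: h2].
move: rb; rewrite lt_min => /andP[r1 rb].
have r0 : 0 < r := le_lt_trans a0 ar.
have [C xC] := xr r ar r1.
have [k0 _ xk] : \forall k \near \oo, `|x_ k - x| <= b ^+ k.
  near=> k; apply: (@le_trans _ _ (C * r ^+ k)); first by near: k.
  by near: k; exact: geometric_decay.
rewrite limn_esup_lim; apply: lime_le; first exact: is_cvg_esups.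
exists k0.+1 => // m /= k0m; apply: ge_ereal_sup => _ [k /= mk <-].
have k0k := leq_trans k0m mk; rewrite lee_fin.
have b0 : 0 <= b by rewrite ltW// (lt_trans r0).
have kn0 : (k%:R : R) != 0 by rewrite pnatr_eq0 -lt0n (leq_trans _ k0k).
rewrite -[leRHS](powRr1 b0) -[in leRHS](divff kn0) powRrM powR_mulrn//.
by apply: ge0_ler_powR; rewrite ?nnegrE ?invr_ge0 ?exprn_ge0// xk//= ltnW.
Unshelve. all: by end_near. Qed.

(** * Convergence controlled by a gauge *)

(** Geometric gauges give the linear rates; an arbitrary vanishing gauge makes
    the same calculus prove plain convergence. *)
Definition cvg_bigO (R : realType) (V : normedModType R) (d : nat -> R)
    (x_ : nat -> V) (x : V) : Prop :=
  exists C, \forall k \near \oo, `|x_ k - x| <= C * d k.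

Section Gauge.
Variables (R : realType) (d : nat -> R).
Hypotheses (d_ge0 : forall k, 0 <= d k) (d_cvg0 : d k @[k --> \oo] --> 0).
Implicit Types V W X : normedModType R.

Lemma cvg_bigO_pos V (x_ : nat -> V) x : cvg_bigO d x_ x ->
  exists2 C, 0 < C & \forall k \near \oo, `|x_ k - x| <= C * d k.
Proof.
move=> [C xC]; exists (`|C| + 1); first by rewrite ltr_wpDl.
apply: filterS xC => k /le_trans; apply; rewrite ler_wpM2r//.
by rewrite (le_trans (ler_norm C))// lerDl.
Qed.

Lemma cvg_bigO_cvg V (x_ : nat -> V) x :
  cvg_bigO d x_ x -> x_ k @[k --> \oo] --> x.
Proof.
move=> /cvg_bigO_pos[C C0 xC]; apply/cvgrPdist_le => e e0.
have /cvgr0Pnorm_le/(_ (e / C)) de := d_cvg0.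
have {}de := de (divr_gt0 e0 C0).
near=> k; rewrite distrC (le_trans (_ : _ <= C * d k))//; first by near: k.
rewrite -ler_pdivlMl// mulrC (le_trans (ler_norm _))//; by near: k.
Unshelve. all: by end_near. Qed.

Lemma cvg_bigO_cst V (x : V) : cvg_bigO d (fun=> x) x.
Proof. by exists 1; near=> k; rewrite subrr normr0 mul1r.
Unshelve. all: by end_near. Qed.

Lemma cvg_bigO_gauge (d' : nat -> R) V (x_ : nat -> V) x :
  (exists C, \forall k \near \oo, d k <= C * d' k) ->
  cvg_bigO d x_ x -> cvg_bigO d' x_ x.
Proof.
move=> [C dC] /cvg_bigO_pos[D D0 xD]; exists (D * C); near=> k.
rewrite (le_trans (_ : _ <= D * d k))//; first by near: k.
rewrite -mulrA ler_pM2l//; by near: k.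
Unshelve. all: by end_near. Qed.

Lemma cvg_bigOD V (x_ y_ : nat -> V) x y :
  cvg_bigO d x_ x -> cvg_bigO d y_ y -> cvg_bigO d (fun k => x_ k + y_ k) (x +
    y).
Proof.
move=> [C xC] [D yD]; exists (C + D); near=> k.
rewrite opprD addrACA (le_trans (ler_normD _ _))// mulrDl lerD//; by near: k.
Unshelve. all: by end_near. Qed.

(** Uses h a b - h x y = h (a - x) (b - y) + h (a - x) y + h x (b - y). *)
Lemma cvg_bigO_bilinear V W X (h : V -> W -> X) (K : R) x_ y_ x y :
  (forall a a' b, h (a - a') b = h a b - h a' b) ->
  (forall a b b', h a (b - b') = h a b - h a b') ->
  (forall a b, `|h a b| <= K * `|a| * `|b|) ->
  cvg_bigO d x_ x -> cvg_bigO d y_ y ->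
  cvg_bigO d (fun k => h (x_ k) (y_ k)) (h x y).
Proof.
move=> hl hr hK /cvg_bigO_pos[C C0 xC] /cvg_bigO_pos[D D0 yD].
have {}hK a b : `|h a b| <= `|K| * `|a| * `|b|.
  by rewrite (le_trans (hK a b))// !ler_wpM2r// ler_norm.
have /cvgr0Pnorm_le/(_ 1 ltr01) d1 := d_cvg0.
exists (`|K| * C * D + `|K| * C * `|y| + `|K| * `|x| * D); near=> k.
have xk : `|x_ k - x| <= C * d k by near: k.
have yk : `|y_ k - y| <= D * d k by near: k.
have dk : d k <= 1 by rewrite (le_trans (ler_norm _))//; near: k.
have -> : h (x_ k) (y_ k) - h x y =
    h (x_ k - x) (y_ k - y) + h (x_ k - x) y + h x (y_ k - y).
  by rewrite !hr !hl subrK addrA subrK.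
rewrite !mulrDl (le_trans (ler_normD _ _))// lerD//; last first.
  by rewrite (le_trans (hK _ _))// -[leRHS]mulrA ler_wpM2l// mulr_ge0.
rewrite (le_trans (ler_normD _ _))// lerD//; last first.
  by rewrite (le_trans (hK _ _))// [leRHS]mulrAC ler_wpM2r//
    -[leRHS]mulrA ler_wpM2l.
rewrite (le_trans (hK _ _))// -!mulrA ler_wpM2l//.
rewrite (le_trans (ler_pM _ _ xk yk))// mulrACA -mulrA !ler_pM2l//.
by rewrite ler_piMl.
Unshelve. all: by end_near. Qed.

Lemma cvg_bigOZ V (a_ : nat -> R) (x_ : nat -> V) (a : R) x :
  cvg_bigO d a_ a -> cvg_bigO d x_ x -> cvg_bigO d (fun k => a_ k *:
    x_ k) (a *: x).
Proof.
apply: (cvg_bigO_bilinear (K := 1)) => [*|*|b y].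
- by rewrite scalerBl.
- by rewrite scalerBr.
- by rewrite normrZ mul1r.
Qed.

Lemma cvg_bigON V (x_ : nat -> V) x :
  cvg_bigO d x_ x -> cvg_bigO d (fun k => - x_ k) (- x).
Proof. by move=> [C xC]; exists C; apply: filterS xC => k;
  rewrite -opprD normrN. Qed.

Lemma cvg_bigOB V (x_ y_ : nat -> V) x y :
  cvg_bigO d x_ x -> cvg_bigO d y_ y -> cvg_bigO d (fun k => x_ k - y_ k) (x -
    y).
Proof. by move=> xx yy; apply: cvg_bigOD => //; exact: cvg_bigON. Qed.

Lemma cvg_bigO_lipschitz V W (F : V -> W) (x_ : nat -> V) x :
  (exists K, \forall y \near x, `|F y - F x| <= K * `|y - x|) ->
  cvg_bigO d x_ x -> cvg_bigO d (F \o x_) (F x).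
Proof.
move=> [K FK] xx; have xcvg := cvg_bigO_cvg xx.
have [C C0 xC] := cvg_bigO_pos xx; exists (`|K| * C).
have {}FK : \forall k \near \oo, `|F (x_ k) - F x| <= K * `|x_ k - x|
  by exact: (xcvg _ FK).
near=> k; rewrite /= (le_trans (_ : _ <= K * `|x_ k - x|))//; first by near: k.
rewrite -mulrA (le_trans (ler_wpM2r _ (ler_norm K)))// ler_wpM2l//; by near: k.
Unshelve. all: by end_near. Qed.

Lemma cvg_bigOV (a_ : nat -> R) a : a != 0 ->
  cvg_bigO d a_ a -> cvg_bigO d (fun k => (a_ k)^-1) a^-1.
Proof.
move=> a0; apply: (@cvg_bigO_lipschitz _ _ (@GRing.inv R)).
have a2 : 0 < `|a| / 2 by rewrite divr_gt0 ?normr_gt0.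
exists (2 / `|a| ^+ 2); near=> y.
have ya : `|a - y| <= `|a| / 2.
  by near: y; have /cvgrPdist_le := @cvg_id _ (nbhs a); apply.
have y2 : `|a| / 2 <= `|y|.
  have := ler_distD 0 a y; rewrite !subr0 sub0r normrN.
  by have := ler_normD y (a - y); rewrite addrC subrK; lra.
have y0 : y != 0 by rewrite -normr_gt0 (lt_le_trans a2).
have -> : y^-1 - a^-1 = (a - y) / (y * a) by field; apply/andP; split.
rewrite normrM distrC mulrC ler_wpM2r// normfV normrM.
rewrite -[leRHS]invf_div lef_pV2 ?posrE ?mulr_gt0 ?normr_gt0//
  ?divr_gt0 ?exprn_gt0 ?normr_gt0//.
by rewrite expr2 mulrAC ler_wpM2r.
Unshelve. all: by end_near. Qed.

End Gauge.

Lemma cvg_bigO_shift (R : realType) (V : normedModType R) (r : R)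
    (x_ : nat -> V) x :
  cvg_bigO (fun k => r ^+ k) x_ x ->
  cvg_bigO (fun k => r ^+ k) (fun k => x_ k.+1) x.
Proof.
move=> [C [k0 _ xC]]; exists (C * r), k0 => // k /= k0k.
by rewrite -mulrA -exprS xC//= leqW.
Qed.

Lemma cvg_bigO_unshift (R : realType) (V : normedModType R) (r : R)
    (x_ : nat -> V) x : r != 0 ->
  cvg_bigO (fun k => r ^+ k) (fun k => x_ k.+1) x ->
  cvg_bigO (fun k => r ^+ k) x_ x.
Proof.
move=> r0 [C [k0 _ xC]]; exists (C / r), k0.+1 => // -[//|k] /= k0k.
by rewrite exprS mulrA divfK// xC.
Qed.

(** * Maximum norm and scalar product *)

Section MatrixNorm.
Variable R : realType.

Lemma norm_entry_le m n (A : 'M[R]_(m, n)) i j : `|A i j| <= `|A|.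
Proof. by rewrite [leRHS]/Num.norm /= mx_normrE (le_bigmax _ _ (i, j)). Qed.

Lemma norm_mx_le m n (A : 'M[R]_(m, n)) c :
  0 <= c -> (forall i j, `|A i j| <= c) -> `|A| <= c.
Proof.
by move=> c0 Ac; rewrite [leLHS]/Num.norm /= mx_normrE bigmax_le// => -[i j] _.
Qed.

Lemma norm_trmx m n (A : 'M[R]_(m, n)) : `|A^T| = `|A|.
Proof.
have le p q (B : 'M[R]_(p, q)) : `|B^T| <= `|B|.
  by apply: norm_mx_le => // i j; rewrite mxE norm_entry_le.
by apply/eqP; rewrite eq_le le/= -{1}(trmxK A) le.
Qed.

Lemma norm_mulmx_le m n p (A : 'M[R]_(m, n)) (B : 'M[R]_(n, p)) :
  `|A *m B| <= n%:R * `|A| * `|B|.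
Proof.
apply: norm_mx_le => [|i j]; first by rewrite !mulr_ge0.
rewrite mxE (le_trans (ler_norm_sum _ _ _))//.
rewrite (le_trans (ler_sum _ (G := fun=> `|A| * `|B|) _))//.
  by move=> k _; rewrite normrM ler_pM// norm_entry_le.
by rewrite sumr_const card_ord -mulrA -[leLHS]mulr_natl.
Qed.

Lemma dotE n (x y : 'cV[R]_n) : dot x y = (x^T *m y) 0 0.
Proof. by rewrite mxE; apply: eq_bigr => k _; rewrite mxE. Qed.

Lemma dot_scalar n (x y : 'cV[R]_n) : x^T *m y = (dot x y)%:M.
Proof. by rewrite dotE -mx11_scalar. Qed.

Lemma norm_dot_le n (x y : 'cV[R]_n) : `|dot x y| <= n%:R * `|x| * `|y|.
Proof.
by rewrite dotE (le_trans (norm_entry_le _ _ _))// -(norm_trmx x) norm_mulmx_le.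
Qed.

Lemma dotZr n a (x y : 'cV[R]_n) : dot x (a *: y) = a * dot x y.
Proof. by rewrite !dotE -scalemxAr mxE. Qed.

Lemma dotBr n (x y z : 'cV[R]_n) : dot x (y - z) = dot x y - dot x z.
Proof. by rewrite !dotE mulmxBr !mxE. Qed.

Lemma dotBl n (x y z : 'cV[R]_n) : dot (x - y) z = dot x z - dot y z.
Proof. by rewrite !dotE linearB mulmxBl !mxE. Qed.

End MatrixNorm.

(** * Growth of matrix powers *)

Lemma normc_modulus (R : realType) (z : R[i]) : `|z| = (modulus z)%:C%C.
Proof. by case: z. Qed.

Lemma modulus_ge0 (R : realType) (z : R[i]) : 0 <= modulus z.
Proof. by rewrite -lecR -normc_modulus; exact: normr_ge0. Qed.

Lemma modulusM (R : realType) (y z : R[i]) :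
  modulus (y * z) = modulus y * modulus z.
Proof. by apply/complexI; rewrite rmorphM /= -!normc_modulus normrM. Qed.

Lemma modulusD (R : realType) (y z : R[i]) :
  modulus (y + z) <= modulus y + modulus z.
Proof. by rewrite -lecR rmorphD /= -!normc_modulus ler_normD. Qed.

Lemma modulus_real (R : realType) (a : R) : modulus a%:C%C = `|a|.
Proof. by rewrite /modulus /= expr0n /= addr0 sqrtr_sqr. Qed.

(** Peeling one factor A - z turns a bound for X (A - z) A^k into a scalar
    recurrence for X A^k, in which the contribution of z has ratio |z| < r. *)
Lemma bounded_orbit_peel (R : realType) (n : nat) (A : 'M[R[i]]_n.+1) (r : R)
    (t : seq R[i]) (X : 'M[R[i]]_n.+1) :
  (forall z, z \in t -> modulus z < r) ->
  (forall i j, exists C, forall k,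
     modulus ((X * \prod_(z <- t) (A - z%:M) * A ^+ k) i j) <= C * r ^+ k) ->
  forall i j, exists C, forall k, modulus ((X * A ^+ k) i j) <= C * r ^+ k.
Proof.
elim: t X => [|z t IH] X tr; first by rewrite big_nil mulr1.
rewrite big_cons mulrA => /IH XA i j.
have [|C XC] := XA _ i j; first by move=> y yt; rewrite tr// inE yt orbT.
have zr : modulus z < r by rewrite tr// inE eqxx.
apply: (geometric_recurrence (modulus_ge0 z) zr (C := C)) => k.
rewrite -modulusM addrC.
have -> : (X * A ^+ k.+1) i j =
    (X * (A - z%:M) * A ^+ k) i j + z * (X * A ^+ k) i j.
  have -> : X * A ^+ k.+1 = X * (A - z%:M) * A ^+ k + z *: (X * A ^+ k).
    rewrite mulrBr mulrBl exprS mulrA -[X * z%:M]/(X *m z%:M) mul_mx_scalar.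
    by rewrite scalerAl subrK.
  by rewrite [LHS]mxE; congr (_ + _); rewrite [LHS]mxE.
by rewrite (le_trans (modulusD _ _))// lerD2r.
Qed.

(** Cayley-Hamilton makes the orbit vanish once all the factors of the
    characteristic polynomial are inserted, so that peeling can start. *)
Lemma power_bound (R : realType) (n : nat) (A : 'M[R]_n) (s : seq R[i]) (r :
  R) :
  char_poly (toC A) = \prod_(z <- s) ('X - z%:P) -> 0 < r ->
  (forall z, z \in s -> modulus z < r) ->
  exists C, forall k, `|A ^+ k| <= C * r ^+ k.
Proof.
case: n A => [|n] A chA r0 sr.
  by exists 0 => k; rewrite mul0r; apply: norm_mx_le => // -[].
have CH : \prod_(z <- s) (toC A - z%:M) = 0.
  rewrite -(Cayley_Hamilton (toC A)) chA rmorph_prod; apply: eq_bigr => z _.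
  by rewrite rmorphB /= horner_mx_X horner_mx_C.
have entry i j : exists C, forall k, `|(A ^+ k) i j| <= C * r ^+ k.
  have [|C AleC] := @bounded_orbit_peel R n (toC A) r s 1 sr _ i j.
    move=> i' j'; exists 0 => k; rewrite mul0r CH mulr0 mul0r mxE.
    by rewrite modulus_real normr0.
  exists C => k; rewrite -modulus_real; have := AleC k; rewrite mul1r.
  by rewrite -(rmorphXn (map_mx (real_complex R))) mxE.
have [C AleC] : {C : 'I_n.+1 -> 'I_n.+1 -> R |
    forall i j k, `|(A ^+ k) i j| <= C i j * r ^+ k}.
  have /choice[C AleC] : forall i, exists C : 'I_n.+1 -> R,
      forall j k, `|(A ^+ k) i j| <= C j * r ^+ k.
    by move=> i; have /choice[C AleC] := entry i; exists C.
  by exists C.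
exists (\sum_i \sum_j `|C i j|) => k; apply: norm_mx_le => [|i j].
  by rewrite mulr_ge0 ?exprn_ge0 ?(ltW r0)// sumr_ge0// => l _; exact: sumr_ge0.
rewrite (le_trans (AleC i j k))// ler_wpM2r ?exprn_ge0 ?(ltW r0)//.
rewrite (le_trans (ler_norm _))// (bigD1 i)//= (bigD1 j)//= -addrA lerDl.
by rewrite addr_ge0 ?sumr_ge0// => l _; exact: sumr_ge0.
Qed.

(** * Deflation of the principal eigenvalue *)

(** Both sides come from the determinant of the bordered matrix
    [[a, - b u]; [v^T, 1]], triangularized by columns in two ways. *)
Lemma det_rank1_update (R : comNzRingType) (n : nat) (a b : R) (u v :
  'cV[R]_n) :
  a * \det (a%:M + b *: (u *m v^T)) = a ^+ n * (a + b * (v^T *m u) 0 0).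
Proof.
pose T : 'M[R]_(n + 1) := block_mx a%:M (- (b *: u)) (v^T) 1%:M.
have detT : \det T = \det (a%:M + b *: (u *m v^T)).
  have := det_mulmx T (block_mx 1%:M 0 (- v^T) 1%:M).
  rewrite mulmx_block !mulmx1 !mulmx0 !mul1mx add0r addrC subrr add0r.
  rewrite mulmxN mulNmx opprK -scalemxAl addrC det_ublock !det1 det_lblock
    !det1.
  by rewrite !mulr1 => <-.
have := det_mulmx T (block_mx 1%:M (b *: u) 0 a%:M).
rewrite mulmx_block !mulmx1 !mulmx0 !addr0 mul1mx mul_scalar_mx mul_mx_scalar.
rewrite scalerN subrr det_lblock det_ublock det1 mul1r !det_scalar expr1 detT.
rewrite [RHS]mulrC => <-; rewrite [in RHS]addrC; congr (_ * _).
by rewrite det_mx11 -scalemxAr !mxE eqxx mulr1n.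
Qed.

(** As (X - M) u = (X - lambda) u, the matrix (X - M) (X - lambda + lambda u v^T)
    is X - lambda times the characteristic matrix of M - lambda u v^T. Hence the
    eigenvalue lambda moves to 0 and all the others keep their multiplicities. *)
Lemma char_poly_deflation (F : fieldType) (n : nat) (M : 'M[F]_n) (lambda : F)
    (u v : 'cV[F]_n) : M *m u = lambda *: u -> v^T *m u = 1%:M ->
  char_poly (M - lambda *: (u *m v^T)) * ('X - lambda%:P) = 'X * char_poly M.
Proof.
move=> Mu vu; pose a : {poly F} := 'X - lambda%:P.
pose Pu := map_mx polyC u; pose Pv := map_mx polyC v.
have chi_u : char_poly_mx M *m Pu = a *: Pu.
  rewrite mulmxBl mul_scalar_mx -map_mxM Mu map_mxZ.
  by rewrite /a scalerBl.
have factor : char_poly_mx M *m (a%:M + lambda%:P *: (Pu *m Pv^T)) =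
    a *: char_poly_mx (M - lambda *: (u *m v^T)).
  rewrite mulmxDr mul_mx_scalar -scalemxAr mulmxA chi_u -scalemxAl.
  rewrite scalerA mulrC -scalerA -scalerDr; congr (_ *: _).
  rewrite /char_poly_mx map_mxB map_mxZ map_mxM -map_trmx opprB.
  by rewrite [in RHS]addrA [in RHS]addrAC.
have a0 : a != 0 by rewrite polyXsubC_eq0.
have /(congr1 (fun p => a * p)) := congr1 determinant factor.
rewrite det_mulmx detZ mulrCA det_rank1_update.
rewrite /Pv map_trmx -map_mxM vu map_scalar_mx mxE eqxx mulr1n /= mulr1.
rewrite {2}/a subrK mulrCA [RHS]mulrCA => /(mulfI (expf_neq0 _ a0)) chi.
by rewrite mulrC [RHS]mulrC [RHS]chi.
Qed.

(** The eigenvalue is a quotient of real numbers: an entry of A x by a nonzero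
    entry of x. *)
Lemma real_eigenvalue (R : realType) (n : nat) (A : 'M[R]_n) (x : 'cV[R]_n)
    (z : R[i]) : x != 0 -> toC A *m toC x = z *: toC x ->
  exists2 mu : R, z = (mu%:C)%C & A *m x = mu *: x.
Proof.
move=> x0; rewrite /toC -map_mxM => Ax.
have /cV0Pn[k xk] := x0.
have zE : z = (((A *m x) k 0 / x k 0)%:C)%C.
  move/matrixP: Ax => /(_ k 0); rewrite !mxE => AxE.
  rewrite rmorphM fmorphV /= AxE mulfK//.
  by rewrite fmorph_eq0.
exists ((A *m x) k 0 / x k 0) => //.
apply: (@map_mx_inj _ _ (real_complex R)); by rewrite Ax zE map_mxZ.
Qed.

Section Principal.
Variables (R : realType) (n : nat) (M : 'M[R]_n) (s : seq R[i]) (lambda : R).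
Variables (u v : 'cV[R]_n).
Hypotheses (hM : dominant_spectrum M s) (s0 : s`_0 = (lambda%:C)%C).
Hypotheses (Mu : M *m u = lambda *: u) (vM : v^T *m M = lambda *: v^T).
Hypothesis (vu : dot v u = 1).

Let vu1 : v^T *m u = 1%:M. Proof. by rewrite dot_scalar vu. Qed.

Lemma deflated_spectrum : exists t : seq R[i],
  char_poly (toC (M - lambda *: (u *m v^T))) = \prod_(z <- t) ('X - z%:P) /\
  forall z, z \in t -> modulus z <= modulus s`_1.
Proof.
have [[chM sorted_s] s1] := hM; case: s s0 s1 chM sorted_s => [|z t] /= zl s1.
  by rewrite ltxx in s1.
rewrite big_cons => chM tz; exists (0 :: t); split; last first.
  move=> y; rewrite inE => /predU1P[->|].
    by rewrite modulus_real normr0 modulus_ge0.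
  case: t tz {s1 chM} => //= z' t /andP[_ tz'];
    rewrite inE => /predU1P[->//|yt].
  have tr : transitive (fun z z' : R[i] => modulus z' <= modulus z).
    by move=> a b c /[swap]; exact: le_trans.
  by have /allP/(_ _ yt) := order_path_min tr tz'.
have toCB : toC (M - lambda *: (u *m v^T)) =
    toC M - (lambda%:C)%C *: (toC u *m (toC v)^T).
  by rewrite /toC map_mxB map_mxZ map_mxM map_trmx.
have Muc : toC M *m toC u = (lambda%:C)%C *: toC u.
  by rewrite -map_mxM Mu map_mxZ.
have vuc : (toC v)^T *m toC u = 1%:M.
  by rewrite map_trmx -map_mxM vu1 map_scalar_mx rmorph1.
have := char_poly_deflation Muc vuc.
rewrite -toCB chM -zl big_cons subr0 mulrCA mulrC => H.
by apply: mulfI H; rewrite polyXsubC_eq0.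
Qed.

Lemma principal_neq0 : lambda != 0.
Proof.
have [_] := hM; rewrite s0 modulus_real => /(le_lt_trans (modulus_ge0 _)).
by rewrite normr_gt0.
Qed.

(** G is the reduced resolvent: it inverts M - lambda on the complement of the
    principal direction and kills that direction. *)
Lemma reduced_resolvent : exists G : 'M[R]_n,
  G *m (M - lambda%:M) = 1%:M - u *m v^T /\ G *m u = 0.
Proof.
have l0 := principal_neq0; pose B := M - lambda *: (u *m v^T).
have Bl : B - lambda%:M \in unitmx.
  rewrite -row_free_unit -kermx_eq0; apply/negPn/negP => Bl0.
  have : eigenvalue B lambda by [].
  rewrite eigenvalue_root_char -(fmorph_root (real_complex R)) map_char_poly.
  have [t [-> tz]] := deflated_spectrum.
  rewrite root_prod_XsubC => /tz; apply/negP; rewrite -ltNge.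
  by have [_] := hM; rewrite s0.
have Bu : (B - lambda%:M) *m u = - lambda *: u.
  rewrite !mulmxBl Mu mul_scalar_mx -scalemxAl -mulmxA vu1 mulmx1.
  by rewrite subrr add0r scaleNr.
have Su : invmx (B - lambda%:M) *m u = - lambda^-1 *: u.
  rewrite -[LHS](scalerK (_ : - lambda != 0)) ?oppr_eq0//
    scalemxAr -Bu mulKmx//.
  by rewrite invrN.
have P1 : (1%:M - u *m v^T) *m u = 0.
  by rewrite mulmxBl mul1mx -mulmxA vu1 mulmx1 subrr.
exists ((1%:M - u *m v^T) *m invmx (B - lambda%:M)); split; last first.
  by rewrite -mulmxA Su -scalemxAr P1 scaler0.
have -> : M - lambda%:M = (B - lambda%:M) + lambda *: (u *m v^T).
  by rewrite addrAC subrK.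
rewrite -mulmxA mulmxDr mulVmx// -scalemxAr mulmxA Su -scalemxAl scalerA mulrN.
by rewrite divff// scaleN1r mulmxBr mulmx1 mulmxA P1 mul0mx subr0.
Qed.

End Principal.

(** * Differentials *)

Section Differentials.
Variables (R : realType) (V W : normedModType R).

Lemma differential_of_estimate (F : V -> W) (x : V) (L : {linear V -> W}) :
  continuous L ->
  (forall e, 0 < e -> \forall y \near x, `|F y - F x - L (y - x)| <= e * `|y -
    x|) ->
  differentiable F x /\ 'd F x = L :> (V -> W).
Proof.
move=> cL FL.
have expansion : F \o shift x = cst (F x) + L +o_ 0 id.
  apply/eqaddoP => e e0; have /nbhs0P := FL e e0; apply: filterS => h /=.
  by rewrite [x + h]addrC addrK opprD addrA.
have dF := diff_unique cL expansion.
by split=> //; apply/diff_locallyP; rewrite dF.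
Qed.

Lemma differential_estimate (F : V -> W) (x : V) : differentiable F x ->
  forall e, 0 < e ->
    \forall y \near x, `|F y - F x - 'd F x (y - x)| <= e * `|y - x|.
Proof.
move=> /diff_locally/eqaddoP Fd e e0; apply/nbhs0P;
  apply: filterS (Fd e e0) => h.
by rewrite /= ![x + h]addrC addrK opprD addrA.
Qed.

(** This is the form in which the differentiability of N enters the scheme. *)
Lemma differentiable_lipschitz (F : V -> W) (x : V) : differentiable F x ->
  exists K, \forall y \near x, `|F y - F x| <= K * `|y - x|.
Proof.
move=> dF; have [k _ dk] := linear_lipschitz (diff_continuous dF).
exists (1 + k); apply: filterS (differential_estimate dF ltr01) => y Fy.
by rewrite -[F y - F x](subrK ('d F x (y - x))) (le_trans (ler_normD _ _))//
  mulrDl lerD.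
Qed.

Lemma linear_continuous_of_bound (L : {linear V -> W}) (K : R) :
  (forall x, `|L x| <= K * `|x|) -> continuous L.
Proof.
move=> LK; apply/linear_bounded_continuous/linear_boundedP.
near=> r => x; rewrite (le_trans (LK x))// ler_wpM2r//.
Unshelve. all: by end_near. Qed.

End Differentials.

Section Gradient.
Variables (R : realType) (n : nat).

Lemma diff_gradient (F : 'cV[R]_n -> R) x : differentiable F x ->
  forall h, 'd F x h = dot (gradient F x) h.
Proof.
move=> dF h; rewrite {1}(matrix_sum_delta h) linear_sum.
apply: eq_bigr => k _; rewrite big_ord1 linearZ /= mulrC; congr (_ * _).
by rewrite mxE deriveE.
Qed.

(** Euler's identity: along the ray through x, N is linear. *)
Lemma gradient_homogeneous (N : 'cV[R]_n -> R) (x : 'cV[R]_n) :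
  (forall (a : R) y, 0 <= a -> N (a *: y) = a * N y) -> differentiable N x ->
  dot (gradient N x) x = N x.
Proof.
move=> Nhom dN; rewrite -diff_gradient//.
have small e : 0 < e -> `|N x - 'd N x x| <= e * `|x|.
  move=> e0; have /nbhs0P Nx := differential_estimate dN e0.
  have Nt := near0Z x Nx.
  have : \forall t \near (0 : R), `|t| < 1 /\
    `|N (x + t *: x) - N x - 'd N x (x + t *: x - x)| <= e * `|x + t *: x - x|.
    near=> t; split; last by near: t.
    by near: t; have /cvgr0Pnorm_lt := @cvg_id _ (nbhs (0 : R)); apply.
  move=> /nbhs_ballP[r /= r0 /(_ (Num.min r 1 / 2))] [].
    rewrite /ball /= sub0r normrN gtr0_norm ?divr_gt0 ?lt_min ?r0 ?ltr01//.
    have rm : Num.min r 1 <= r by rewrite ge_min lexx.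
    by rewrite ltr_pdivrMr//; move: r0 rm => /=; lra.
  have : 0 < Num.min r 1 / 2 by rewrite divr_gt0 ?lt_min ?r0 ?ltr01.
  move: (Num.min r 1 / 2) => t t0 t1.
  have -> : x + t *: x = (t + 1) *: x by rewrite scalerDl scale1r addrC.
  have -> : (t + 1) *: x - x = t *: x by rewrite scalerDl scale1r addrK.
  rewrite Nhom; last by rewrite addr_ge0// ltW.
  rewrite mulrDl mul1r addrK linearZ /= -[t * N x]/(t *: N x).
  rewrite -scalerBr !normrZ mulrCA.
  have nt0 : 0 < `|t| by rewrite gtr0_norm.
  by rewrite (ler_pM2l nt0).
apply/eqP; rewrite eq_sym -subr_eq0 -normr_eq0 eq_le normr_ge0 andbT.
apply/ler_addgt0Pr => e e0; rewrite add0r.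
have x1 : 0 < `|x| + 1 by rewrite ltr_wpDl.
rewrite (le_trans (small (e / (`|x| + 1)) _)) ?divr_gt0//.
by rewrite mulrAC ler_pdivrMr// ler_pM2l// lerDl.
Unshelve. all: by end_near. Qed.

End Gradient.

(** * Differentiability of the normalized eigenvector *)

(** An error that is small against the increment of F itself is small against
    the increment of the variable: taking eta = 1/2 first shows that F is
    Lipschitz at x. *)
Lemma implicit_differential (R : realType) (V W : normedModType R) (F : V -> W)
    (x : V) (L : {linear V -> W}) : continuous L ->
  (forall eta, 0 < eta ->
    \forall y \near x, `|F y - F x - L (y - x)| <= eta * `|F y - F x|) ->
  differentiable F x /\ 'd F x = L :> (V -> W).
Proof.
move=> cL FL; apply: differential_of_estimate => // e e0.
have [l l0 Ll] := linear_lipschitz cL.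
have h0 : (0 : R) < 2^-1 by rewrite invr_gt0.
near=> y; have half : `|F y - F x - L (y - x)| <= 2^-1 * `|F y - F x|.
  by near: y; exact: FL.
have Fl : `|F y - F x| <= 2 * l * `|y - x|.
  have := ler_normD (F y - F x - L (y - x)) (L (y - x)); rewrite subrK.
  have := Ll (y - x); lra.
have FLe : `|F y - F x - L (y - x)| <= e / (2 * l) * `|F y - F x|.
  by near: y; apply: FL; rewrite divr_gt0// mulr_gt0.
have el0 : 0 <= e / (2 * l) by rewrite divr_ge0 ?mulr_ge0 ?(ltW e0) ?(ltW l0).
rewrite (le_trans FLe)// (le_trans (ler_wpM2l el0 Fl))// mulrA divfK//.
by rewrite mulf_neq0 ?gt_eqF.
Unshelve. all: by end_near. Qed.

Section Perturbation.
Variables (R : realType) (n : nat) (M G : 'M[R]_n) (lambda : R).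
Variables (u v p : 'cV[R]_n).
Hypotheses (Mu : M *m u = lambda *: u) (vM : v^T *m M = lambda *: v^T).
Hypothesis pu : dot p u = 1.
Hypotheses (GM : G *m (M - lambda%:M) = 1%:M - u *m v^T) (Gu : G *m u = 0).

(** The linear response of the eigenvector: G solves the perturbed eigenvector
    equation modulo u, and the oblique projection 1 - u p^T restores the
    linearized normalization dot p delta = 0. *)
Definition eigenvector_response (H : 'M[R]_n) : 'cV[R]_n :=
  - (((1%:M - u *m p^T) *m G) *m (H *m u)).

(** The correction dot p delta u is small: N is constant along the branch and
    p is its gradient. *)
Lemma perturbation_identity (A : 'M[R]_n) (x : 'cV[R]_n) (mu : R) :
  A *m x = mu *: x ->
  x - u - eigenvector_response (A - M) =
  ((1%:M - u *m p^T) *m G) *m ((mu - lambda) *: (x - u) - (A - M) *m (x - u)) +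
  dot p (x - u) *: u.
Proof.
move=> Ax; set d := x - u; set H := A - M; set Q := 1%:M - u *m p^T.
have Qu : Q *m u = 0.
  by rewrite mulmxBl mul1mx -mulmxA dot_scalar pu mulmx1 subrr.
have Md : (M - lambda%:M) *m d = (mu - lambda) *: x - H *m x.
  rewrite /d mulmxBr [X in _ - X]mulmxBl Mu mul_scalar_mx subrr subr0.
  by rewrite !mulmxBl Ax mul_scalar_mx scalerBl opprB [RHS]addrC addrA subrK.
have Pd : (1%:M - u *m v^T) *m d + G *m (H *m u) =
    G *m ((mu - lambda) *: d - H *m d).
  rewrite -GM -mulmxA Md !mulmxBr -!scalemxAr /d !mulmxBr Gu subr0.
  by rewrite opprB addrA addrAC.
have Qd : Q *m ((1%:M - u *m v^T) *m d) = d - dot p d *: u.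
  rewrite [(_ - u *m v^T) *m d]mulmxBl mul1mx -mulmxA mulmxBr (mulmxA Q) Qu
    mul0mx subr0.
  by rewrite /Q mulmxBl mul1mx -mulmxA dot_scalar mul_mx_scalar.
rewrite /eigenvector_response opprK -!mulmxA -Pd mulmxDr Qd.
by rewrite [RHS]addrAC subrK.
Qed.

Lemma eigenvalue_shift (A : 'M[R]_n) (x : 'cV[R]_n) (mu : R) :
  A *m x = mu *: x -> (mu - lambda) * dot v x = dot v ((A - M) *m x).
Proof.
move=> Ax; rewrite mulmxBl Ax dotBr dotZr mulrBl; congr (_ - _).
by rewrite !dotE mulmxA vM -scalemxAl [RHS]mxE.
Qed.

Lemma eigenvector_response_linear : linear eigenvector_response.
Proof.
move=> a A B; rewrite /eigenvector_response [(_ + B) *m u]mulmxDl mulmxDr opprD.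
by rewrite -scalemxAl -scalemxAr scalerN.
Qed.

HB.instance Definition _ := GRing.isLinear.Build R _ _ _ eigenvector_response
  eigenvector_response_linear.

End Perturbation.

Section Branch.
Variables (R : realType) (n : nat) (N : 'cV[R]_n -> R) (M G : 'M[R]_n).
Variables (lambda : R) (U : 'M[R]_n -> 'cV[R]_n) (v : 'cV[R]_n).
Let u := U M.
Let p := gradient N u.
Hypothesis Nhom : forall (a : R) x, 0 <= a -> N (a *: x) = a * N x.
Hypothesis Ndiff : differentiable N u.
Hypothesis hU : principal_branch N M U.
Hypotheses (Mu : M *m u = lambda *: u) (vM : v^T *m M = lambda *: v^T).
Hypothesis vu : dot v u = 1.
Hypotheses (GM : G *m (M - lambda%:M) = 1%:M - u *m v^T) (Gu : G *m u = 0).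

Lemma normalized_neq0 x : N x = 1 -> x != 0.
Proof.
move=> Nx; apply/eqP => x0; have := Nhom 0 (lexx 0).
by rewrite scaler0 mul0r -x0 Nx => /eqP; rewrite oner_eq0.
Qed.

Lemma branch_normalized : N u = 1.
Proof. by have [/nbhs_singleton[s' []]] := hU. Qed.

Lemma branch_gradient : dot p u = 1.
Proof. by rewrite gradient_homogeneous// branch_normalized. Qed.

Lemma branch_eigenvector : \forall A \near M,
  N (U A) = 1 /\ exists mu, A *m U A = mu *: U A.
Proof.
have [near_M _] := hU; apply: filterS near_M => A [s' [_ Ax Nx]]; split=> //.
by have [mu _ ?] := real_eigenvalue (normalized_neq0 Nx) Ax; exists mu.
Qed.

(** The shift mu - lambda is O(H), so in the perturbation identity the first
    term is O(H delta); the last one is o(delta), since N takes the same value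
    at x and u. *)
Lemma branch_differential :
  differentiable U M /\ 'd U M = eigenvector_response G u p :> (_ -> _).
Proof.
pose L : {linear 'M[R]_n -> 'cV[R]_n} := eigenvector_response G u p.
pose QG := (1%:M - u *m p^T) *m G.
have cL : continuous L.
  apply: (@linear_continuous_of_bound _ _ _ _ (n%:R * `|QG| * n%:R * `|u|)) =>
    H.
  rewrite normrN (le_trans (norm_mulmx_le _ _))// -[leRHS]mulrA -[leRHS]mulrA.
  by rewrite ler_wpM2l ?mulr_ge0// (le_trans (norm_mulmx_le _ _))//
    -mulrA (mulrC `|u|).
apply: (implicit_differential (L := L)) => // eta eta0.
have [_ cU] := hU.
pose K1 := 2 * (n%:R * `|v| * n%:R * (`|u| + 1)).
have K1_ge0 : 0 <= K1 by rewrite !mulr_ge0// addr_ge0.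
pose K2 := n%:R * `|QG| * (K1 + n%:R).
have K2_ge0 : 0 <= K2 by rewrite !mulr_ge0// addr_ge0.
pose e := eta / (2 * (`|u| + 1)).
have e0 : 0 < e by rewrite divr_gt0// mulr_gt0// ltr_wpDl.
have Nu : \forall A \near M,
    `|N (U A) - N u - 'd N u (U A - u)| <= e * `|U A - u|.
  exact: (cU _ (differential_estimate Ndiff e0)).
have Mid : (A : 'M[R]_n) @[A --> M] --> M by [].
have c0 : 0 < eta / (2 * (K2 + 1)) by rewrite divr_gt0// mulr_gt0// ltr_wpDl.
have v0 : 0 < (2 * (n%:R * `|v| + 1))^-1 by rewrite invr_gt0 mulr_gt0//
  ltr_wpDl// mulr_ge0.
near=> A; set x := U A; set d := x - u; set H := A - M.
have [Nx [mu Ax]] : N x = 1 /\ exists mu, A *m x = mu *: x.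
  by rewrite /x; near: A; exact: branch_eigenvector.
have HA : `|H| <= eta / (2 * (K2 + 1)).
  by rewrite /H distrC; near: A; move/cvgrPdist_le : Mid; apply.
have d1 : `|d| <= 1.
  by rewrite /d /x distrC; near: A; move/cvgrPdist_le : cU; apply.
have dv : `|d| <= (2 * (n%:R * `|v| + 1))^-1.
  by rewrite /d /x distrC; near: A; move/cvgrPdist_le : cU; apply.
have vx : 2^-1 <= `|dot v x|.
  have vd : `|dot v d| <= 2^-1.
    rewrite (le_trans (norm_dot_le _ _))//
      (le_trans (ler_wpM2l _ dv)) ?mulr_ge0//.
    rewrite invfM mulrCA -[leRHS]mulr1 ler_wpM2l ?invr_ge0//.
    by rewrite ler_pdivrMr ?ltr_wpDl ?mulr_ge0// mul1r lerDl.
  have -> : dot v x = dot v d + 1 by rewrite /d dotBr vu subrK.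
  have := ler_normD (dot v d + 1) (- dot v d);
    rewrite addrAC subrr add0r normr1 normrN.
  lra.
have x1 : `|x| <= `|u| + 1.
  by rewrite -[x](subrK u) -/d addrC (le_trans (ler_normD _ _))// lerD2l.
have shift : `|mu - lambda| <= K1 * `|H|.
  have : 2^-1 * `|mu - lambda| <= n%:R * `|v| * (n%:R * `|H| * `|x|).
    rewrite (le_trans (ler_wpM2r (normr_ge0 _) vx))// mulrC -normrM.
    rewrite (eigenvalue_shift vM Ax) (le_trans (norm_dot_le _ _))//.
    by rewrite ler_wpM2l ?mulr_ge0// norm_mulmx_le.
  have : n%:R * `|v| * (n%:R * `|H| * `|x|) <= n%:R * `|v| * (n%:R * `|H| *
    (`|u| + 1)).
    by rewrite !ler_wpM2l ?mulr_ge0.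
  rewrite /K1; lra.
have Ndx : `|dot p d| <= e * `|d|.
  have : `|N x - N u - 'd N u d| <= e * `|d|.
    by rewrite /d /x; near: A; exact: Nu.
  by rewrite Nx branch_normalized subrr sub0r normrN diff_gradient.
rewrite (perturbation_identity Mu branch_gradient GM Gu Ax) -/d -/H -/QG.
have w_le : `|(mu - lambda) *: d - H *m d| <= (K1 + n%:R) * `|H| * `|d|.
  rewrite (le_trans (ler_normB _ _))// 2!mulrDl lerD ?norm_mulmx_le//.
  by rewrite normrZ ler_wpM2r.
apply: (@le_trans _ _ (K2 * `|H| * `|d| + e * `|u| * `|d|)).
  rewrite (le_trans (ler_normD _ _))// lerD//.
    rewrite (le_trans (norm_mulmx_le _ _))// /K2 -!mulrA !ler_wpM2l//.
    by rewrite mulrA.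
  by rewrite normrZ mulrAC ler_wpM2r.
rewrite -mulrDl ler_wpM2r// [leRHS](splitr eta) lerD//.
  rewrite (le_trans (ler_wpM2l K2_ge0 HA))// mulrCA -[leRHS]mulr1 -mulrA.
  rewrite ler_wpM2l ?(ltW eta0)// invfM mulrCA ler_wpM2l ?invr_ge0//.
  by rewrite ler_pdivrMr ?ltr_wpDl// mul1r lerDl.
rewrite /e mulrAC -mulrA ler_wpM2l ?(ltW eta0)// invfM mulrCA.
rewrite -[leRHS]mulr1 ler_wpM2l ?invr_ge0//.
by rewrite ler_pdivrMr ?ltr_wpDl// mul1r lerDl.
Unshelve. all: by end_near. Qed.

End Branch.

(** * Linear recurrences with a contracting matrix *)

Section MatrixGauge.
Variables (R : realType) (d : nat -> R).
Hypotheses (d_ge0 : forall k, 0 <= d k) (d_cvg0 : d k @[k --> \oo] --> 0).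

Lemma cvg_bigO_mulmx m n p (A_ : nat -> 'M[R]_(m, n)) (B_ :
  nat -> 'M[R]_(n, p)) A B :
  cvg_bigO d A_ A -> cvg_bigO d B_ B -> cvg_bigO d (fun k => A_ k *m B_ k) (A
    *m B).
Proof.
apply: (cvg_bigO_bilinear d_ge0 d_cvg0 (K := n%:R)) => *.
- exact: mulmxBl.
- exact: mulmxBr.
- exact: norm_mulmx_le.
Qed.

Lemma cvg_bigO_dot n (x_ y_ : nat -> 'cV[R]_n) x y :
  cvg_bigO d x_ x -> cvg_bigO d y_ y -> cvg_bigO d (fun k => dot (x_ k) (y_
    k)) (dot x y).
Proof.
apply: (cvg_bigO_bilinear d_ge0 d_cvg0 (K := n%:R)) => *.
- exact: dotBl.
- exact: dotBr.
- exact: norm_dot_le.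
Qed.

Lemma cvg_bigO_trmx m n (A_ : nat -> 'M[R]_(m, n)) A :
  cvg_bigO d A_ A -> cvg_bigO d (fun k => (A_ k)^T) A^T.
Proof.
move=> [C dA]; exists C; apply: filterS dA => k.
by rewrite -(norm_trmx (A_ k - A)) linearB.
Qed.

End MatrixGauge.

Section Contraction.
Variables (R : realType) (n : nat) (T : 'M[R]_n) (C r : R).
Hypothesis TC : forall k, `|T ^+ k| <= C * r ^+ k.

Lemma expr_mulmx k : T ^+ k.+1 = T *m T ^+ k. Proof. exact: exprS. Qed.

Lemma expr_mulmxr k : T ^+ k.+1 = T ^+ k *m T. Proof. exact: exprSr. Qed.

Lemma orbit_col p (x_ : nat -> 'M[R]_(n, p)) x :
  (forall k, x_ k.+1 - x = T *m (x_ k - x)) -> cvg_bigO (fun k => r ^+ k) x_ x.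
Proof.
move=> xT; have xE k : x_ k - x = T ^+ k *m (x_ 0%N - x).
  elim: k => [|k IH]; first by rewrite expr0 mul1mx.
  by rewrite xT IH mulmxA -expr_mulmx.
exists (n%:R * C * `|x_ 0%N - x|); near=> k.
rewrite (xE k) (le_trans (norm_mulmx_le _ _))// [leRHS]mulrAC ler_wpM2r//.
by rewrite -[leRHS]mulrA ler_wpM2l.
Unshelve. all: by end_near. Qed.

Lemma orbit_row p (x_ : nat -> 'M[R]_(p, n)) x :
  (forall k, x_ k.+1 - x = (x_ k - x) *m T) -> cvg_bigO (fun k => r ^+ k) x_ x.
Proof.
move=> xT; have xE k : x_ k - x = (x_ 0%N - x) *m T ^+ k.
  elim: k => [|k IH]; first by rewrite expr0 mulmx1.
  by rewrite xT IH -mulmxA -expr_mulmxr.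
exists (n%:R * `|x_ 0%N - x| * C); near=> k.
rewrite (xE k) (le_trans (norm_mulmx_le _ _))// -[leRHS]mulrA.
by rewrite ler_wpM2l// mulr_ge0.
Unshelve. all: by end_near. Qed.

Section Perturbed.
Variables (p : nat) (d : nat -> R).
Variables (x_ b_ : nat -> 'M[R]_(p, n)) (x b : 'M[R]_(p, n)) (T_ :
  nat -> 'M[R]_n).
Hypotheses (r0 : 0 < r).
Hypotheses (d_ge0 : forall k, 0 <= d k) (d_cvg0 : d k @[k --> \oo] --> 0).
Hypotheses (b_cvg : cvg_bigO d b_ b) (T_cvg : cvg_bigO d T_ T).
Hypotheses (xS : forall k, x_ k.+1 = b_ k + x_ k *m T_ k) (x_fix :
  x = b + x *m T).

(** The matrix T itself need not contract in the maximum norm, so the norm of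
    the error satisfies no useful recurrence. The majorant m bounds the
    whole orbit of the error under T at once, and this stronger property is
    inherited with ratio r. *)
Lemma perturbed_majorant q : r < q -> exists m : nat -> R,
  (forall k, `|x_ k - x| <= m k) /\
  exists E, \forall k \near \oo, m k.+1 <= q * m k + E * d k.
Proof.
move=> rq; pose e k := x_ k - x.
pose h k := (b_ k - b) + x *m (T_ k - T) + e k *m (T_ k - T).
have eS k : e k.+1 = e k *m T + h k.
  rewrite /h /e xS !(mulmxBl, mulmxBr) [in LHS]x_fix.
  move: (x_ k *m T_ k) (x_ k *m T) (x *m T) (x *m T_ k) => a1 a2 a3 a4.
  by apply/matrixP => i j; rewrite !mxE; ring.
have C0 : 0 <= C.
  by have := TC 0%N; rewrite expr0 mulr1; exact: le_trans.
pose c := n%:R * C.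
have c0 : 0 <= c by rewrite mulr_ge0.
pose m := fix m k := if k is k'.+1 then r * m k' + c * `|h k'| else c * `|e
  0%N|.
have em k j : `|e k *m T ^+ j| <= m k * r ^+ j.
  elim: k j => [|k IH] j /=.
    rewrite (le_trans (norm_mulmx_le _ _))// /c mulrAC -!mulrA (mulrC `|e 0%N|).
    by rewrite !ler_wpM2l// mulrA ler_wpM2r.
  rewrite eS mulmxDl -mulmxA -expr_mulmx (le_trans (ler_normD _ _))//
    mulrDl lerD//.
    by rewrite (le_trans (IH _))// exprS mulrCA mulrA.
  rewrite (le_trans (norm_mulmx_le _ _))// /c -mulrA [leRHS](_ :
    _ = n%:R * (`|h k| * (C * r ^+ j))); last by ring.
  by rewrite !ler_wpM2l.
have e_le k : `|e k| <= m k by have := em k 0%N; rewrite !expr0 mulmx1 mulr1.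
have [D D0 bD] := cvg_bigO_pos d_ge0 b_cvg.
have [D' D'0 TD] := cvg_bigO_pos d_ge0 T_cvg.
exists m; split=> //.
pose E := c * (D + n%:R * `|x| * D'); exists E.
pose E' := c * (n%:R * D').
have E'0 : 0 <= E' by rewrite mulr_ge0// mulr_ge0// ltW.
have qr0 : 0 < (q - r) / (E' + 1) by rewrite divr_gt0 ?subr_gt0// ltr_wpDl.
have /cvgr0Pnorm_le/(_ _ qr0) d_small := d_cvg0.
near=> k; have bk : `|b_ k - b| <= D * d k by near: k.
have Tk : `|T_ k - T| <= D' * d k by near: k.
have dk : E' * d k <= q - r.
  have : d k <= (q - r) / (E' + 1).
    by rewrite (le_trans (ler_norm _))//; near: k.
  rewrite ler_pdivlMr ?ltr_wpDl//.
  by have := d_ge0 k; rewrite mulrDr mulr1 mulrC; lra.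
have m0 : 0 <= m k by exact: le_trans (e_le k).
have hk : `|h k| <= D * d k + n%:R * `|x| * (D' * d k) + n%:R * m k * (D' * d
  k).
  rewrite (le_trans (ler_normD _ _))// lerD//.
    rewrite (le_trans (ler_normD _ _))// lerD//.
    by rewrite (le_trans (norm_mulmx_le _ _))// ler_wpM2l// mulr_ge0.
  rewrite (le_trans (norm_mulmx_le _ _))// ler_pM ?mulr_ge0//.
  by rewrite ler_wpM2l.
have := ler_wpM2l c0 hk; have := ler_wpM2r m0 dk; rewrite /E /E' /=.
lra.
Unshelve. all: by end_near. Qed.

Lemma perturbed_cvg : r < 1 -> x_ k @[k --> \oo] --> x.
Proof.
move=> r1; have [q rq q1] : exists2 q, r < q & q < 1.
  by have /midf_lt[] := r1; eexists; eassumption.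
have [m [xm [E mE]]] := perturbed_majorant rq.
have m_cvg : m k @[k --> \oo] --> 0.
  apply: (vanishing_recurrence (a := fun k => E * d k)) q1 _ _ mE.
  - exact: ltW (lt_trans r0 rq).
  - by move=> k; exact: le_trans (xm k).
  - by rewrite -[X in _ --> X](mulr0 E); exact: cvgMl_tmp.
apply/cvgrPdist_le => e e0; move/cvgr0Pnorm_le : m_cvg => /(_ e e0).
apply: filterS => k; rewrite distrC; apply: le_trans.
by rewrite (le_trans (xm k))// ler_norm.
Qed.

Lemma perturbed_geometric q : r < q ->
  (exists D, \forall k \near \oo, d k <= D * r ^+ k) ->
  cvg_bigO (fun k => q ^+ k) x_ x.
Proof.
move=> rq [D dD]; have [rp pq] := midf_lt rq; set p' := _ / 2 in rp pq.
have q0 := lt_trans r0 rq.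
have [m [xm [E mE]]] := perturbed_majorant rp.
have mq : \forall k \near \oo, m k.+1 <= p' * m k + `|E| * `|D| * q ^+ k.
  near=> k; apply: (@le_trans _ _ (p' * m k + E * d k)); first by near: k.
  have dk : d k <= D * r ^+ k by near: k.
  rewrite lerD2l (le_trans (ler_wpM2r _ (ler_norm E)))// -mulrA ler_wpM2l//.
  rewrite (le_trans dk)// (le_trans (ler_wpM2r _ (ler_norm D))) ?exprn_ge0
    ?(ltW r0)//.
  by rewrite ler_wpM2l// lerXn2r ?nnegrE ?(ltW r0) ?(ltW q0) ?(ltW rq).
have [|F mF] := geometric_recurrence_near _ pq mq;
  first exact: ltW (lt_trans r0 rp).
by exists F; apply: filterS mF => k; apply: le_trans.
Unshelve. all: by end_near. Qed.

End Perturbed.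
End Contraction.

(** * The iterative scheme *)

Section Scheme.
Variables (R : realType) (n : nat) (f N : 'cV[R]_n -> R) (M :
  'M[R]_n) (lambda : R).
Variables (u v : 'cV[R]_n) (u_ v_ w_ : nat -> 'cV[R]_n).
Hypothesis l0 : lambda != 0.
Hypotheses (Mu : M *m u = lambda *: u) (vM : v^T *m M = lambda *: v^T).
Hypothesis vu : dot v u = 1.
Hypothesis scheme : iterative_scheme f N M u_ v_ w_.
Hypotheses (hu0 : dot v (u_ 0%N) != 0) (hv0 : dot (v_ 0%N) u != 0).

Let rho l := N (M *m u_ l).

Lemma rho_neq0 l : rho l != 0.
Proof. by have [[]] := scheme l. Qed.

Lemma u_next l : u_ l.+1 = (rho l)^-1 *: (M *m u_ l).
Proof. by have [_ ->] := scheme l. Qed.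

Lemma dot_u_next l : dot v (u_ l.+1) = (rho l)^-1 * (lambda * dot v (u_ l)).
Proof.
rewrite u_next dotZr; congr (_ * _).
by rewrite !dotE mulmxA vM -scalemxAl [LHS]mxE.
Qed.

Lemma dot_u_neq0 l : dot v (u_ l) != 0.
Proof.
elim: l => // l IH; rewrite dot_u_next !mulf_neq0 ?invr_neq0//.
exact: rho_neq0.
Qed.

(** The scalars by which N has to commute in the power iteration are covered
    in both cases of the sign condition: all of them when N is odd, and
    otherwise positive ones only. *)
Lemma sign_homogeneous :
  (forall (a : R) x, 0 <= a -> N (a *: x) = a * N x) ->
  sign_condition N M (lambda%:C)%C v u_ ->
  [/\ forall x, N (lambda *: x) = lambda * N x,
      forall l x, N ((rho l)^-1 *: x) = (rho l)^-1 * N x &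
      forall l x, N (dot v (u_ l) *: x) = dot v (u_ l) * N x].
Proof.
move=> Nhom [Nodd|[]].
  have homR a x : N (a *: x) = a * N x.
    have [/Nhom//|a0] := leP 0 a.
    by rewrite -[a]opprK scaleNr Nodd Nhom ?oppr_ge0 ?(ltW a0)// -mulNr.
  by split=> *; rewrite homR.
rewrite -[0]/((0%:C)%C) ltcR => lpos vpos rpos; split=> [x|l x|l x].
- by rewrite Nhom ?ltW.
- by rewrite Nhom ?invr_ge0 ?ltW ?rpos.
rewrite Nhom//; apply: ltW; elim: l => // l IH.
by rewrite dot_u_next !mulr_gt0 ?invr_gt0 ?rpos.
Qed.

Section Rate.
Variables (C r : R).
Let T : 'M[R]_n := lambda^-1 *: (M - lambda *: (u *m v^T)).
Hypotheses (TC : forall k, `|T ^+ k| <= C * r ^+ k) (r0 : 0 < r) (r1 : r < 1).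
Hypotheses (Nhom : forall (a : R) x, 0 <= a -> N (a *: x) = a * N x).
Hypothesis hsign : sign_condition N M (lambda%:C)%C v u_.
Hypotheses (Ndiff : differentiable N u) (Nu : N u = 1).

Let g k := r ^+ k.
Let g_ge0 k : 0 <= g k. Proof. by rewrite exprn_ge0// ltW. Qed.
Let g_cvg0 : g k @[k --> \oo] --> 0.
Proof. by apply: cvg_expr; rewrite gtr0_norm. Qed.

Let N_lipschitz := differentiable_lipschitz Ndiff.

Lemma deflated_actionE (x : 'cV[R]_n) : T *m x = lambda^-1 *:
  (M *m x) - u *m (v^T *m x).
Proof.
rewrite -scalemxAl mulmxBl scalerBr -scalemxAl scalerA mulVf// scale1r.
by rewrite mulmxA.
Qed.

(** Rescaled to dot v z = 1, the power iteration is affine, with linear part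
    the deflated matrix divided by lambda; the normalization by N is undone at
    the end. *)
Lemma scheme_u_cvg : cvg_bigO g u_ u.
Proof.
have [_ Nrho Ndot] := sign_homogeneous Nhom hsign.
pose z l := (dot v (u_ l))^-1 *: u_ l.
have vz l : v^T *m z l = 1%:M.
  by rewrite dot_scalar dotZr mulVf// dot_u_neq0.
have uz l : u_ l = dot v (u_ l) *: z l.
  by rewrite scalerA divff ?dot_u_neq0// scale1r.
have z_next l : z l.+1 = lambda^-1 *: (M *m z l).
  rewrite /z dot_u_next u_next -scalemxAr !scalerA; congr (_ *: _).
  have := rho_neq0 l; have := dot_u_neq0 l => h1 h2.
  by field; rewrite l0 h1 h2.
have z_cvg : cvg_bigO g z u.
  apply: (orbit_col TC) => l; rewrite mulmxBr !deflated_actionE vz Mu scalerA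
    mulVf// scale1r.
  by rewrite dot_scalar vu mulmx1 subrr subr0 -z_next.
have Nz_cvg := cvg_bigOV g_ge0 g_cvg0 (_ : N u != 0)
  (cvg_bigO_lipschitz g_ge0 g_cvg0 N_lipschitz z_cvg).
have := cvg_bigOZ g_ge0 g_cvg0 (Nz_cvg _) z_cvg.
rewrite Nu invr1 scale1r => /(_ (oner_neq0 _)) /cvg_bigO_shift zN_cvg.
apply: (cvg_bigO_unshift (lt0r_neq0 r0)).
have -> // : (fun k => u_ k.+1) = (fun k => (N (z k.+1))^-1 *: z k.+1).
apply/funext => k; rewrite {1}uz; congr (_ *: _).
have Nk : N (u_ k.+1) = 1 by rewrite u_next Nrho mulVf ?rho_neq0.
have : dot v (u_ k.+1) * N (z k.+1) = 1 by rewrite -Ndot -uz.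
by move=> /(canRL (mulKf (dot_u_neq0 _))); rewrite mulr1 => ->; rewrite invrK.
Qed.

(** Since lambda may be negative, M u_l is first divided by lambda, so that it
    tends to u, where N is differentiable. *)
Lemma scheme_rho_cvg : cvg_bigO g rho lambda.
Proof.
have [Nlambda _ _] := sign_homogeneous Nhom hsign.
have Mu_cvg : cvg_bigO g (fun l => lambda^-1 *: (M *m u_ l)) u.
  have -> : u = lambda^-1 *: (M *m u) by rewrite Mu scalerA mulVf// scale1r.
  apply: cvg_bigOZ => //; first exact: cvg_bigO_cst.
  by apply: cvg_bigO_mulmx => //; [exact: cvg_bigO_cst|exact: scheme_u_cvg].
have N_cvg := cvg_bigO_lipschitz g_ge0 g_cvg0 N_lipschitz Mu_cvg.
have := cvg_bigOZ g_ge0 g_cvg0 (cvg_bigO_cst g_ge0 lambda) N_cvg.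
rewrite Nu /GRing.scale /= mulr1; congr cvg_bigO; apply/funext => l /=.
by rewrite -Nlambda scalerA divff// scale1r.
Qed.

(** For l > 0 the scheme enforces v_l . u_l = 1, so v_l is the row
    iterate y_l, affine with linear part T, divided by y_l . u_l. *)
Lemma scheme_v_cvg : cvg_bigO g v_ v.
Proof.
pose delta l := ((v_ l)^T *m M *m u_ l.+1) 0 0.
have delta0 l : delta l != 0 by have [[]] := scheme l.
have v_next l : (v_ l.+1)^T = (delta l)^-1 *: ((v_ l)^T *m M).
  by have [] := scheme l.
have dot_next l : dot (v_ l.+1) u = (delta l)^-1 * (lambda * dot (v_ l) u).
  rewrite !dotE v_next -scalemxAl -mulmxA Mu -scalemxAr.
  by rewrite [LHS]mxE; congr (_ * _); rewrite [LHS]mxE.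
have dot0 l : dot (v_ l) u != 0.
  by elim: l => // l IH; rewrite dot_next !mulf_neq0 ?invr_neq0.
pose y l := (dot (v_ l) u)^-1 *: (v_ l)^T.
have yu l : y l *m u = 1%:M.
  by rewrite -scalemxAl dot_scalar scale_scalar_mx mulVf.
have y_next l : y l.+1 = lambda^-1 *: (y l *m M).
  rewrite /y dot_next v_next -scalemxAl !scalerA; congr (_ *: _).
  by have := delta0 l; have := dot0 l => h1 h2; field; rewrite l0 h1 h2.
have y_cvg : cvg_bigO g y v^T.
  apply: (orbit_row TC) => l; rewrite /T -scalemxAr mulmxBr -scalemxAr mulmxA.
  rewrite [_ *m u]mulmxBl yu dot_scalar vu subrr mul0mx scaler0 subr0 mulmxBl
    scalerBr.
  by rewrite -y_next vM scalerA mulVf// scale1r.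
have yu_cvg : cvg_bigO g (fun l => dot (y l)^T (u_ l)) 1.
  rewrite -vu; apply: cvg_bigO_dot => //; last exact: scheme_u_cvg.
  by rewrite -[v]trmxK; exact: cvg_bigO_trmx.
have := cvg_bigOZ g_ge0 g_cvg0 (cvg_bigOV g_ge0 g_cvg0 (oner_neq0 _) yu_cvg)
  y_cvg.
rewrite invr1 scale1r => /cvg_bigO_trmx /cvg_bigO_shift; rewrite trmxK => vy.
apply: (cvg_bigO_unshift (lt0r_neq0 r0)).
have -> // : (fun k => v_ k.+1) =
    (fun k => ((dot (y k.+1)^T (u_ k.+1))^-1 *: y k.+1)^T).
apply/funext => k; rewrite -[LHS]trmxK; congr (_^T).
have -> : dot (y k.+1)^T (u_ k.+1) = (dot (v_ k.+1) u)^-1.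
  rewrite dotE trmxK -scalemxAl [LHS]mxE v_next -scalemxAl [X in _ * X]mxE.
  by rewrite mulVf ?mulr1.
by rewrite invrK /y scalerA divff// scale1r.
Qed.

Section Adjoint.
Variable G : 'M[R]_n.
Hypotheses (GM : G *m (M - lambda%:M) = 1%:M - u *m v^T) (Gu : G *m u = 0).
Let df := gradient f u.
Let p := gradient N u.
Let c : 'rV[R]_n := df^T - dot df u *: p^T.
(* The errors of the two gradients enter the gauge, so that one computation
   serves both the plain and the linear convergence of w. *)
Let d k := g k + `|gradient f (u_ k) - df| + `|gradient N (u_ k) - p|.
Hypotheses (f_cont : {for u, continuous (gradient f)}).
Hypotheses (N_cont : {for u, continuous (gradient N)}).

(** The fixed point of w^T = (c + w^T M) (1 - u v^T) / lambda. As G u = 0, it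
    is orthogonal to u, and as G (M - lambda) = 1 - u v^T, it satisfies
    w^T (lambda - M) = c (1 - u v^T). *)
Definition adjoint_limit : 'cV[R]_n := - (c *m G)^T.

Let d_ge0 k : 0 <= d k.
Proof. by rewrite !addr_ge0. Qed.

Let d_cvg0 : d k @[k --> \oo] --> 0.
Proof.
have u_cvg := cvg_bigO_cvg g_ge0 g_cvg0 scheme_u_cvg.
have grad_cvg F : {for u, continuous (gradient F)} ->
    `|gradient F (u_ k) - gradient F u| @[k --> \oo] --> 0.
  move=> F_cont; apply/cvgr0Pnorm_le => e e0.
  have /cvgrPdist_le/(_ e e0) := cvg_comp _ _ u_cvg F_cont.
  by apply: filterS => k; rewrite normr_id distrC.
rewrite -[X in _ --> X](addr0 0) -[X in _ --> X + _](addr0 0).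
by apply: cvgD; [apply: cvgD => //; exact: grad_cvg|exact: grad_cvg].
Qed.

Let g_le_d (V : normedModType R) (x_ : nat -> V) x :
  cvg_bigO g x_ x -> cvg_bigO d x_ x.
Proof.
apply: cvg_bigO_gauge => //; exists 1; near=> k.
by rewrite mul1r /d -addrA lerDl addr_ge0.
Unshelve. all: by end_near. Qed.

Let Pi l := 1%:M - u_ l.+1 *m (v_ l.+1)^T.
(* The step for w is w^T |-> b_ l + w^T T_ l. *)
Let T_ l := (rho l)^-1 *: (M *m Pi l).
Let c_ l := (gradient f (u_ l))^T -
  dot (gradient f (u_ l)) (u_ l) *: (gradient N (u_ l))^T.
Let b_ l := (rho l)^-1 *: (c_ l *m Pi l).

Let Pi_cvg : cvg_bigO d Pi (1%:M - u *m v^T).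
Proof.
apply: cvg_bigOB => //; first exact: cvg_bigO_cst.
apply: cvg_bigO_mulmx => //.
  exact/g_le_d/cvg_bigO_shift/scheme_u_cvg.
exact/cvg_bigO_trmx/g_le_d/cvg_bigO_shift/scheme_v_cvg.
Qed.

Let rhoV_cvg : cvg_bigO d (fun l => (rho l)^-1) lambda^-1.
Proof. by apply: cvg_bigOV => //; exact/g_le_d/scheme_rho_cvg. Qed.

Let T_cvg : cvg_bigO d T_ T.
Proof.
have -> : T = lambda^-1 *: (M *m (1%:M - u *m v^T)).
  by rewrite mulmxBr mulmx1 mulmxA Mu -scalemxAl.
apply: cvg_bigOZ => //; apply: cvg_bigO_mulmx => //; exact: cvg_bigO_cst.
Qed.

Let b_cvg : cvg_bigO d b_ (lambda^-1 *: (c *m (1%:M - u *m v^T))).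
Proof.
have f_cvg : cvg_bigO d (fun l => gradient f (u_ l)) df.
  by exists 1; near=> k; rewrite mul1r /d addrAC lerDr addr_ge0.
have N_cvg : cvg_bigO d (fun l => gradient N (u_ l)) p.
  by exists 1; near=> k; rewrite mul1r /d lerDr addr_ge0.
apply: cvg_bigOZ => //; apply: cvg_bigO_mulmx => //.
apply: cvg_bigOB => //; first exact: cvg_bigO_trmx.
apply: cvg_bigOZ => //; last exact: cvg_bigO_trmx.
by apply: cvg_bigO_dot => //; exact/g_le_d/scheme_u_cvg.
Unshelve. all: by end_near. Qed.

Let w_next l : (w_ l.+1)^T = b_ l + (w_ l)^T *m T_ l.
Proof.
have [_ _ _ ->] := scheme l.
by rewrite mulmxDl scalerDr -scalemxAr mulmxA.
Qed.

Let w_fixed : adjoint_limit^T =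
  lambda^-1 *: (c *m (1%:M - u *m v^T)) + adjoint_limit^T *m T.
Proof.
rewrite /adjoint_limit linearN /= trmxK -GM.
have -> : T = lambda^-1 *: (M - lambda%:M) + 1%:M - u *m v^T.
  rewrite /T !scalerBr scale_scalar_mx mulVf// subrK.
  by rewrite scalerA mulVf// scale1r.
rewrite [(- _) *m _]mulmxBr [(- _) *m (_ + _)]mulmxDr mulmx1 !mulNmx -!mulmxA.
rewrite [G *m (u *m _)]mulmxA Gu mul0mx mulmx0 oppr0 subr0 -!scalemxAr.
by rewrite addrA subrr add0r.
Qed.

Lemma scheme_w_cvg : w_ l @[l --> \oo] --> adjoint_limit.
Proof.
have := perturbed_cvg TC r0 d_ge0 d_cvg0 b_cvg T_cvg w_next w_fixed r1.
move=> /cvgrPdist_le w_cvg; apply/cvgrPdist_le => e e0.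
by apply: filterS (w_cvg e e0) => k; rewrite -linearB norm_trmx.
Qed.

Lemma scheme_w_geometric q : gradient_lipschitz_at f u ->
  gradient_lipschitz_at N u ->
  r < q -> cvg_bigO (fun k => q ^+ k) w_ adjoint_limit.
Proof.
move=> f_lip N_lip rq.
have [A fA] := cvg_bigO_lipschitz g_ge0 g_cvg0 f_lip scheme_u_cvg.
have [B NB] := cvg_bigO_lipschitz g_ge0 g_cvg0 N_lip scheme_u_cvg.
have d_g : exists D, \forall k \near \oo, d k <= D * r ^+ k.
  exists (1 + A + B); near=> k; rewrite /d !mulrDl mul1r !lerD//; by near: k.
have := perturbed_geometric TC r0 d_ge0 d_cvg0 b_cvg T_cvg w_next w_fixed rq
  d_g.
move=> /cvg_bigO_trmx; rewrite trmxK; congr cvg_bigO.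
by apply/funext => k; rewrite trmxK.
Unshelve. all: by end_near. Qed.

Lemma scheme_gradient_cvg :
  w_ l *m (u_ l)^T @[l --> \oo] --> adjoint_limit *m u^T.
Proof.
have u_cvg := cvg_bigO_cvg g_ge0 g_cvg0 scheme_u_cvg.
pose d' k := `|w_ k - adjoint_limit| + `|u_ k - u|.
have d'_ge0 k : 0 <= d' k by rewrite addr_ge0.
have norm_cvg (V : normedModType R) (x_ : nat -> V) (x : V) :
  x_ k @[k --> \oo] --> x ->
    `|x_ k - x : V| @[k --> \oo] --> (0 : R).
  move=> x_cvg; apply/cvgr0Pnorm_le => e e0.
  by move/cvgrPdist_le : x_cvg => /(_ e e0); apply: filterS => k;
    rewrite normr_id distrC.
have d'_cvg : d' k @[k --> \oo] --> 0.
  by rewrite -[X in _ --> X](addr0 0); apply: cvgD; apply: norm_cvg => //;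
    exact: scheme_w_cvg.
apply: (cvg_bigO_cvg d'_ge0 d'_cvg); apply: cvg_bigO_mulmx => //.
  by exists 1; near=> k; rewrite mul1r lerDl.
by apply: cvg_bigO_trmx; exists 1; near=> k; rewrite mul1r lerDr.
Unshelve. all: by end_near. Qed.

End Adjoint.
End Rate.
End Scheme.

(** * The derivative of the eigenvector functional *)

Lemma chain_rule (R : realType) (n : nat) (f : 'cV[R]_n -> R)
    (U : 'M[R]_n -> 'cV[R]_n) (M : 'M[R]_n) :
  differentiable U M -> differentiable f (U M) ->
  forall i j, 'D_(delta_mx i j) (f \o U) M = chain_rule_derivative f U M i j /\
    chain_rule_derivative f U M i j = dot (gradient f (U M)) ('d U M (delta_mx
      i j)).
Proof.
move=> dU df i j.
have gE : chain_rule_derivative f U M i j =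
    dot (gradient f (U M)) ('d U M (delta_mx i j)).
  rewrite mxE; apply: eq_bigr => k _; congr (_ * _).
  by rewrite -deriveE// derive_mx ?mxE//; exact: diff_derivable.
split=> //; rewrite gE -diff_gradient// deriveE;
  last exact: differentiable_comp.
by rewrite diff_comp.
Qed.

(** The two projections agree: (grad f)^T (1 - u p^T) is the row vector c of the
    scheme, so that the derivative in the direction H is w^T H u. *)
Lemma response_adjoint (R : realType) (n : nat) (f N : 'cV[R]_n -> R)
    (G : 'M[R]_n) (u : 'cV[R]_n) (i j : 'I_n) :
  dot (gradient f u) (eigenvector_response G u (gradient N u) (delta_mx i j)) =
  (adjoint_limit f N u G *m u^T) i j.
Proof.
set df := gradient f u; set p := gradient N u; set E := delta_mx i j.
have -> : dot df (eigenvector_response G u p E) = ((adjoint_limit f N u G)^T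
  *m E *m u) 0 0.
  rewrite /adjoint_limit linearN /= trmxK dotE /eigenvector_response mulmxN
    !mulNmx.
  congr (fun_of_matrix (- _) _ _); rewrite !mulmxA; do 3 congr (_ *m _).
  by rewrite mulmxBr mulmx1 mulmxA dot_scalar mul_scalar_mx.
rewrite /E -(mul_delta_mx (0 : 'I_1)) mulmxA -colE -mulmxA -rowE.
by rewrite [LHS]mxE [RHS]mxE !big_ord1 !mxE.
Qed.

Theorem theorem1 (R : realType) (n : nat)
    (f N : 'cV[R]_n -> R) (M : 'M[R]_n) (s : seq R[i])
    (U : 'M[R]_n -> 'cV[R]_n) (v : 'cV[R]_n) (u_ v_ w_ : nat -> 'cV[R]_n)
    (* s lists the eigenvalues lambda_1, lambda_2, ... of M *)
    (hM : dominant_spectrum M s)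
    (hf : continuously_differentiable f)
    (hNhom : forall (a : R) (x : 'cV[R]_n), 0 <= a -> N (a *: x) = a * N x)
    (hNdiff : differentiable N (U M))
    (hU : principal_branch N M U)
    (* the left principal eigenvector *)
    (hv : (toC v)^T *m toC M = s`_0 *: (toC v)^T)
    (hvu : dot v (U M) = 1)
    (hscheme : iterative_scheme f N M u_ v_ w_)
    (* the starting vectors are not degenerate *)
    (hu0 : dot v (u_ 0%N) != 0)
    (hv0 : dot (v_ 0%N) (U M) != 0)
    (hsign : sign_condition N M s`_0 v u_) :
  let u := U M in
  let g := chain_rule_derivative f U M in
  let rate := modulus s`_1 / modulus s`_0 in
  [/\ differentiable U M /\ differentiable (f \o U) M,
      (forall i j, 'D_(delta_mx i j) (f \o U) M = g i j),
      linear_cvg u_ u rate,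
      linear_cvg v_ v rate &
      (continuously_differentiable_at N u ->
       (w_ l *m (u_ l)^T @[l --> \oo] --> g) /\
       (exists w : 'cV[R]_n,
          (w_ l @[l --> \oo] --> w) /\
          (gradient_lipschitz_at f u -> gradient_lipschitz_at N u ->
           linear_cvg w_ w rate)))].
Proof.
move=> u g rate.
have v0 : v != 0.
  apply/eqP => v0; move: hvu; rewrite v0 dotE trmx0 mul0mx mxE => /eqP.
  by rewrite eq_sym oner_eq0.
have [lambda s0 vM] : exists2 lambda :
  R, s`_0 = (lambda%:C)%C & v^T *m M = lambda *: v^T.
  have [|lambda s0 Mv] := @real_eigenvalue R n M^T v s`_0 v0.
    have -> : toC M^T = (toC M)^T by rewrite /toC map_trmx.
    by rewrite -[toC v]trmxK -trmx_mul hv linearZ.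
  by exists lambda => //; rewrite -[LHS]trmxK trmx_mul trmxK Mv linearZ.
have Mu : M *m u = lambda *: u.
  have [_ [mu Mu]] := nbhs_singleton (branch_eigenvector hNhom hU).
  rewrite Mu; congr (_ *: _).
  have : dot v (M *m u) = lambda * dot v u.
    by rewrite !dotE mulmxA vM -scalemxAl [LHS]mxE.
  by rewrite Mu dotZr hvu !mulr1.
have l0 := principal_neq0 hM s0.
have [G [GM Gu]] := reduced_resolvent hM s0 Mu hvu.
have Nu := branch_normalized hU.
have [dU dUE] := branch_differential hNhom hNdiff hU Mu vM hvu GM Gu.
have df : differentiable f u by case: hf.
have gE : g = adjoint_limit f N u G *m u^T.
  apply/matrixP => i j; have [_ ->] := chain_rule dU df i j.
  by rewrite dUE response_adjoint.
move: hsign; rewrite s0 => sign.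
have rate0 : 0 <= rate by rewrite divr_ge0 ?modulus_ge0.
have rate1 : rate < 1.
  have [_] := hM; rewrite /rate s0 modulus_real => h.
  by rewrite ltr_pdivrMr ?normr_gt0// mul1r.
pose T : 'M[R]_n := lambda^-1 *: (M - lambda *: (u *m v^T)).
have T_bound r : rate < r -> exists C, forall k, `|T ^+ k| <= C * r ^+ k.
  move=> rater; have r0 := le_lt_trans rate0 rater.
  have [t [chB tz]] := deflated_spectrum hM s0 Mu hvu.
  have al : 0 < `|lambda| by rewrite normr_gt0.
  have [|z zt|C BC] := power_bound (r := r * `|lambda|) chB;
    first exact: mulr_gt0.
    rewrite (le_lt_trans (tz z zt))// -ltr_pdivrMr//.
    by move: rater; rewrite /rate s0 modulus_real.
  exists C => k; have -> : T ^+ k = lambda^-1 ^+ k *: (M - lambda *: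
    (u *m v^T)) ^+ k.
    elim: k => [|k IH]; first by rewrite !expr0 scale1r.
    by rewrite (expr_mulmx T k) IH -scalemxAl -scalemxAr scalerA -exprS
      -expr_mulmx.
  rewrite normrZ normrX normfV exprVn ler_pdivrMl ?exprn_gt0//.
  by rewrite (le_trans (BC k))// exprMn mulrA mulrC.
have r_pos r : rate < r -> 0 < r := le_lt_trans rate0.
split; first by split=> //; exact: differentiable_comp.
- by move=> i j; have [] := chain_rule dU df i j.
- apply: linear_cvg_geometric => // r rr r1; have [C TC] := T_bound r rr.
  exact: (scheme_u_cvg l0 Mu vM hvu hscheme hu0 TC (r_pos r rr) r1 hNhom sign
    hNdiff Nu).
- apply: linear_cvg_geometric => // r rr r1; have [C TC] := T_bound r rr.
  exact: (scheme_v_cvg l0 Mu vM hvu hscheme hu0 hv0 TC (r_pos r rr) r1 hNhom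
    sign hNdiff Nu).
move=> [_ N_cont].
have f_cont : {for u, continuous (gradient f)} := hf.2 u.
have [r1 rr1 r11] : exists2 r1, rate < r1 & r1 < 1.
  by have /midf_lt[] := rate1; eexists; eassumption.
have [C TC] := T_bound r1 rr1.
split.
  rewrite gE; exact: (scheme_gradient_cvg l0 Mu vM hvu hscheme hu0 hv0 TC
    (r_pos _ rr1)
    r11 hNhom sign hNdiff Nu GM Gu f_cont N_cont).
exists (adjoint_limit f N u G); split.
  exact: (scheme_w_cvg l0 Mu vM hvu hscheme hu0 hv0 TC (r_pos _ rr1)
    r11 hNhom sign hNdiff Nu GM Gu f_cont N_cont).
move=> f_lip N_lip; apply: linear_cvg_geometric => // r rr r_lt1.
have [q rq qr] : exists2 q, rate < q & q < r.
  by have /midf_lt[] := rr; eexists; eassumption.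
have [C' TC'] := T_bound q rq.
exact: (scheme_w_geometric l0 Mu vM hvu hscheme hu0 hv0 TC' (r_pos _ rq)
  (lt_trans qr r_lt1) hNhom sign hNdiff Nu GM Gu f_cont N_cont f_lip N_lip qr).
Qed.
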